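(* Let $m\ge 2$, let $n_1,\dots,n_m\ge 3$ be odd, and let $\mathcal{C}=\mathcal{C}(C_{n_1},\dots,C_{n_m})$ be the odd chain cycle. Let $V_1=\{v^2_1,\dots,v^m_1\}$ and $V_2=V(\mathcal{C})\setminus V_1$ (so each vertex of $V_2$ has a unique name $v^i_j$ and lies in exactly one cycle $C_{n_i}$). Let $v^i_j,v^k_l\in V_2$ be distinct. (a) If $i=k$, then $v^i_j$ and $v^i_l$ are mutually maximally distant in $\mathcal{C}$ if and only if $d(v^i_j,v^i_l)=(n_i-1)/2$ (the diameter of $C_{n_i}$). (b) Suppose $i<k$. Then: (1) if $i=1$ and $k=m$: $v^1_j$ and $v^m_l$ are mutually maximally distant iff $j\in\{1,2\}$ and $l\in\{\frac{n_m+1}{2},\frac{n_m+1}{2}+1\}$; (2) if $i=1$ and $2\le k\le m-1$: $v^1_j$ and $v^k_l$ are mutually maximally distant iff $j\in\{1,2\}$ and $l=\frac{n_k+1}{2}$; (3) if $2\le i\le m-1$ and $k=m$: $v^i_j$ and $v^m_l$ are mutually maximally distant iff $j=2$ and $l\in\{\frac{n_m+1}{2},\frac{n_m+1}{2}+1\}$; (4) if $2\le i<k\le m-1$: $v^i_j$ and $v^k_l$ are mutually maximally distant iff $j=2$ and $l=\frac{n_k+1}{2}$.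
   Context: Let $C_{n_1},\dots,C_{n_m}$ be pairwise disjoint cycles, $V(C_{n_i})=\{v^i_1,\dots,v^i_{n_i}\}$ with $v^i_j$ adjacent to $v^i_{j+1}$ (indices mod $n_i$). The odd chain cycle $\mathcal{C}(C_{n_1},\dots,C_{n_m})$ (all $n_i$ odd) is obtained by identifying $v^i_{(n_i+1)/2+1}$ with $v^{i+1}_1$ for each $i=1,\dots,m-1$; the identified vertex carries both names. A vertex $u$ is maximally distant from $v$ if every neighbor $w$ of $u$ satisfies $d(v,w)\le d(u,v)$; $u,v$ are mutually maximally distant if each is maximally distant from the other. *)

(* Defs.v *)
From mathcomp Require Import all_boot.
Unset Printing Implicit Defensive.

Definition walk_len {T : finType} (e : rel T) (u v : T) (k : nat) : bool :=
  [exists p : k.-tuple T, path e u p && (last u p == v)].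

(* shortest-path distance: least k admitting a walk of length k
   (a shortest path has < #|T| edges; returns #|T| if v is unreachable,
   which never happens in the connected graphs considered here) *)
Definition gdist {T : finType} (e : rel T) (u v : T) : nat :=
  find (walk_len e u v) (iota 0 #|T|).

Definition max_distant {T : finType} (e : rel T) (u v : T) : Prop :=
  forall w : T, e u w -> gdist e v w <= gdist e u v.

Definition mutually_max_distant {T : finType} (e : rel T) (u v : T) : Prop :=
  max_distant e u v /\ max_distant e v u.

(* Names v^i_j are pairs (i,j) of naturals, 1 <= i <= m, 1 <= j <= n i. *)

Definition cbound (m : nat) (n : nat -> nat) : nat := (\max_(i < m.+1) n i).+1.

Definition cname (m : nat) (n : nat -> nat) : finType :=
  ('I_m.+1 * 'I_(cbound m n))%type.

Definition pr (m : nat) (n : nat -> nat) (x : cname m n) : nat * nat :=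
  (nat_of_ord x.1, nat_of_ord x.2).

Definition glue (ni : nat) : nat := (ni.+1)./2.+1.

Definition valid_name (m : nat) (n : nat -> nat) (x : nat * nat) : bool :=
  [&& 1 <= x.1 <= m & 1 <= x.2 <= n x.1].

(* v^i_{(n_i+1)/2+1} is identified with v^{i+1}_1 (i < m); the identified
   vertex is represented by the name v^{i+1}_1 *)
Definition canon (m : nat) (n : nat -> nat) (x : nat * nat) : nat * nat :=
  if (x.1 < m) && (x.2 == glue (n x.1)) then (x.1.+1, 1) else x.

(* v^i_j adjacent to v^i_{j+1}, indices mod n_i (taking values 1..n_i) *)
Definition cyc_adj (n : nat -> nat) (x y : nat * nat) : bool :=
  (x.1 == y.1) && ((y.2 == x.2 %% n x.1 + 1) || (x.2 == y.2 %% n y.1 + 1)).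

Definition is_vertex (m : nat) (n : nat -> nat) (x : nat * nat) : bool :=
  valid_name m n x && (canon m n x == x).

Definition chain_adj (m : nat) (n : nat -> nat) : rel (cname m n) :=
  fun u v => [exists a : cname m n, exists b : cname m n,
    [&& valid_name m n (pr m n a), valid_name m n (pr m n b),
        cyc_adj n (pr m n a) (pr m n b),
        canon m n (pr m n a) == pr m n u & canon m n (pr m n b) == pr m n v]].

Definition chain_dist (m : nat) (n : nat -> nat) (u v : cname m n) : nat :=
  gdist (chain_adj m n) u v.

Definition in_V2 (m : nat) (n : nat -> nat) (x : nat * nat) : bool :=
  is_vertex m n x && ~~ ((2 <= x.1) && (x.2 == 1)).

Definition vtx (m : nat) (n : nat -> nat) (i j : nat) : cname m n :=
  (inord i, inord j).

(* Main.v *)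
(** All paths from [v] to a cycle [C_i] enter it at one gate (the vertex [v]
    itself when it lies on [C_i]), so on [C_i] the distance to [v] is a constant
    plus the distance, along the cycle, to the gate. The neighbours of a vertex
    of [V_2] lie on its own cycle, hence being maximally distant from [v] is a
    local-maximum condition on an odd cycle, which holds exactly at the two
    antipodes of the gate. Discarding the antipodes that are cut vertices gives
    the stated lists. *)
Require Import Defs.
From mathcomp Require Import all_boot.
From mathcomp Require Import zify.

(** * Graph distance computed from a potential function *)

Lemma walk_lenP (T : finType) (e : rel T) (u v : T) (k : nat) :
  reflect (exists p : seq T, [/\ size p = k, path e u p & last u p = v])
          (walk_len e u v k).
Proof.
apply: (iffP existsP) => [[p /andP[ep /eqP lp]]|[p [sp ep lp]]].
  by exists p; rewrite size_tuple.
have sp' : size p == k by apply/eqP.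
by exists (Tuple sp'); rewrite /= ep lp eqxx.
Qed.

(** The Lipschitz condition makes every walk from [u] to [x] at least [f x] long, and repeated
    descent builds a walk of exactly that length. Descent is only asked on [P], since the finite
    type of names also contains elements that are not vertices. *)
Lemma gdist_potential (T : finType) (e : rel T) (P : pred T) (u : T)
    (f : T -> nat) :
  f u = 0 ->
  (forall x y, e x y -> f y <= (f x).+1) ->
  (forall x, P x -> x != u -> exists y, [/\ P y, e y x & f x = (f y).+1]) ->
  forall x, P x -> gdist e u x = f x.
Proof.
move=> fu lip desc x Px.
have lb p y : path e y p -> f (last y p) <= f y + size p.
  elim: p y => [|z p IH] y /=; first by rewrite addn0.
  by case/andP=> /lip eyz /IH; lia.
have ub : exists p, [/\ size p = f x, path e u p & last u p = x].
  have [d] := ubnP (f x); elim: d x Px => // d IH x Px fx.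
  have [->|xu] := eqVneq x u; first by exists [::]; rewrite fu.
  have [y [Py eyx fxy]] := desc x Px xu.
  have [|p [sp ep lp]] := IH y Py; first by lia.
  by exists (rcons p x); rewrite size_rcons rcons_path last_rcons lp ep sp fxy.
have walk_ge k : walk_len e u x k -> f x <= k.
  by case/walk_lenP=> p [<- ep <-]; rewrite -[size p]add0n -fu lb.
(* [gdist] only tries lengths below [#|T|]. Shortening the walk to a duplicate-free one, still of
   length at least [f x], puts [f x] in that range. *)
have fx_lt : f x < #|T|.
  have [p [_ ep lp]] := ub; case/shortenP: ep lp => p' ep' up' _ lp.
  have := card_uniqP up' => /= cp; apply: (@leq_trans (size p').+1).
    by rewrite ltnS; apply: walk_ge; apply/walk_lenP; exists p'.
  by rewrite -cp max_card.
have walk_fx : walk_len e u x (f x) by apply/walk_lenP.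
have has_walk : has (walk_len e u x) (iota 0 #|T|).
  by apply/hasP; exists (f x); rewrite ?mem_iota.
apply/eqP; rewrite eqn_leq /gdist; apply/andP; split.
  rewrite leqNgt; apply/negP => /(before_find 0).
  by rewrite nth_iota // walk_fx.
have := nth_find 0 has_walk; rewrite nth_iota; first by move/walk_ge.
by rewrite -[X in _ < X](size_iota 0) -has_find.
Qed.

(** * Adjacency and distance along a single cycle *)

Definition cdist (n a b : nat) : nat :=
  minn ((a - b) + (b - a)) (n - ((a - b) + (b - a))).

Definition cnext (n a b : nat) : bool := b == a %% n + 1.

Lemma cnextP (n a b : nat) : 1 <= a <= n ->
  reflect (a < n /\ b = a.+1 \/ a = n /\ b = 1) (cnext n a b).
Proof.
move=> an; apply: (iffP eqP).
  have [lt_an|ge_an] := ltnP a n; first by rewrite modn_small //; lia.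
  have -> : a = n by lia.
  by rewrite modnn; lia.
case=> [[lt_an ->]|[-> ->]]; first by rewrite modn_small //; lia.
by rewrite modnn.
Qed.

Definition cadj (n a b : nat) : bool := cnext n a b || cnext n b a.

Lemma cadjC (n a b : nat) : cadj n a b = cadj n b a.
Proof. exact: orbC. Qed.

Lemma cadjP (n a b : nat) : 1 <= a <= n -> 1 <= b <= n ->
  reflect [\/ b = a.+1, a = b.+1, a = n /\ b = 1 | b = n /\ a = 1] (cadj n a b).
Proof.
move=> an bn; apply: (iffP orP).
  by case=> [/(cnextP _ _ _ an)|/(cnextP _ _ _ bn)] [] [? ?];
    [constructor 1|constructor 3|constructor 2|constructor 4].
case=> [E|E|E|E]; [left|right|left|right]; apply/cnextP => //; lia.
Qed.

Lemma cdistC (n a b : nat) : cdist n a b = cdist n b a.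
Proof. rewrite /cdist; lia. Qed.

Lemma cdistxx (n a : nat) : cdist n a a = 0.
Proof. rewrite /cdist; lia. Qed.

Lemma cdist_lip (n a b g : nat) : 1 <= a <= n -> 1 <= b <= n -> 1 <= g <= n ->
  cadj n a b -> cdist n b g <= (cdist n a g).+1.
Proof. by move=> an bn gn /cadjP[] //; rewrite /cdist; lia. Qed.

Lemma cadj_neighbours (n a : nat) : 1 <= a <= n ->
  let up := if a < n then a.+1 else 1 in
  let dn := if 1 < a then a.-1 else n in
  [/\ 1 <= up <= n, 1 <= dn <= n, cadj n a up & cadj n a dn].
Proof.
move=> an up dn.
have upn : 1 <= up <= n by rewrite /up; case: (ltnP a n); lia.
have dnn : 1 <= dn <= n by rewrite /dn; case: (ltnP 1 a); lia.
split=> //; apply/cadjP => //.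
  rewrite /up; case: ltnP => ?; first by constructor 1.
  by constructor 3; lia.
rewrite /dn; case: ltnP => ?; first by constructor 2; lia.
by constructor 4; lia.
Qed.

Lemma cdist_desc (n a g : nat) : 1 <= a <= n -> 1 <= g <= n -> a != g ->
  exists b, [/\ 1 <= b <= n, cadj n b a & cdist n a g = (cdist n b g).+1].
Proof.
move=> an gn ag; have := cadj_neighbours _ _ an.
set up := if _ then _ else 1; set dn := if _ then _ else n.
move=> [upn dnn upa dna].
have [/eqP E|E] := boolP (cdist n a g == (cdist n up g).+1).
  by exists up; rewrite cadjC.
exists dn; rewrite cadjC; split=> //.
move: E; rewrite /cdist /up /dn.
by case: (ltnP a n) => ?; case: (ltnP 1 a) => ?; lia.
Qed.

(** Away from the two antipodes of [g], one of the two neighbours of [a] is strictly farther from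
    [g]; at the antipodes the distance has its largest possible value. *)
Lemma cdist_local_max (n a g : nat) : odd n -> 1 < n ->
  1 <= a <= n -> 1 <= g <= n ->
  (forall b, 1 <= b <= n -> cadj n a b -> cdist n b g <= cdist n a g) <->
  cdist n a g = n./2.
Proof.
move=> on n1 an gn; split=> [H|H b bn _]; last by rewrite H /cdist; lia.
have [upn dnn /(H _ upn) + /(H _ dnn)] := cadj_neighbours _ _ an.
by rewrite /cdist; case: (ltnP a n) => ?; case: (ltnP 1 a) => ?; lia.
Qed.

Lemma cdist_antipode_glue (n a : nat) : odd n -> 3 <= n -> 1 <= a <= n ->
  cdist n a (glue n) = n./2 <-> a = 1 \/ a = 2.
Proof. by move=> on n3 an; rewrite /cdist /glue; lia. Qed.

Lemma cdist_antipode1 (n a : nat) : odd n -> 3 <= n -> 1 <= a <= n ->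
  cdist n a 1 = n./2 <-> a = n.+1./2 \/ a = glue n.
Proof. by move=> on n3 an; rewrite /cdist /glue; lia. Qed.

(** * Distances in the chain *)

Section Chain.

Variables (m : nat) (n : nat -> nat).
Hypothesis n_odd : forall t, 1 <= t <= m -> odd (n t) /\ 3 <= n t.

(** The cost of crossing the cycles strictly between [i] and [k]: each is traversed from its name 1
    to its glue point. *)
Definition gap (i k : nat) : nat := \sum_(i.+1 <= t < k) (n t)./2.

(* The vertex of cycle [i] through which every path from [v] enters it, and
   the distance from [v] to it. *)
Definition gate (v : nat * nat) (i : nat) : nat :=
  if i == v.1 then v.2 else if i < v.1 then glue (n i) else 1.

Definition gate_dist (v : nat * nat) (i : nat) : nat :=
  if i == v.1 then 0
  else if i < v.1 then gap i v.1 + cdist (n v.1) v.2 1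
  else gap v.1 i + cdist (n v.1) v.2 (glue (n v.1)).

Definition ndist (v x : nat * nat) : nat :=
  gate_dist v x.1 + cdist (n x.1) x.2 (gate v x.1).

Lemma ndistC (v x : nat * nat) : ndist v x = ndist x v.
Proof.
case: v x => [k l] [i j]; rewrite /ndist /gate_dist /gate /= [k == i]eq_sym.
by case: ltngtP => [||->]; rewrite 1?[cdist _ j l]cdistC; lia.
Qed.

Lemma glue_valid (t : nat) : 1 <= t <= m -> 1 <= glue (n t) <= n t.
Proof. by move=> /n_odd[on n3]; rewrite /glue; lia. Qed.

Lemma gate_valid (v : nat * nat) (i : nat) : valid_name m n v ->
  1 <= i <= m -> 1 <= gate v i <= n i.
Proof.
move=> /andP[v1 v2] im; rewrite /gate; case: eqP => [->//|_].
by case: ifP => _; [apply: glue_valid|have := n_odd i im; lia].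
Qed.

Lemma gap_nil (i k : nat) : k <= i.+1 -> gap i k = 0.
Proof. by move=> ki; rewrite /gap big_geq. Qed.

Lemma gap_recl (i k : nat) : i.+1 < k -> gap i k = (n i.+1)./2 + gap i.+1 k.
Proof. by move=> ik; rewrite /gap big_ltn. Qed.

Lemma gap_recr (i k : nat) : i < k -> gap i k.+1 = gap i k + (n k)./2.
Proof. by move=> ik; rewrite /gap big_nat_recr. Qed.

Lemma cdist_1_glue (t : nat) :
  1 <= t <= m -> cdist (n t) 1 (glue (n t)) = (n t)./2.
Proof. by move=> /n_odd[on n3]; rewrite /cdist /glue; lia. Qed.

(** [ndist] is computed on names, so the two names of a cut vertex must give the same value. Passing
    from one to the other moves a term [(n t)./2] between [gap] and the distance along a cycle. *)
Lemma ndist_canon (v x : nat * nat) :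
  valid_name m n v -> valid_name m n x -> ndist v (canon m n x) = ndist v x.
Proof.
case: v x => [k l] [i j] /andP[/= km ln] /andP[/= im jn].
rewrite /canon /=; case: andP => [[lt_im /eqP ->]|//].
rewrite /ndist /gate_dist /gate /=.
have [lt_ik|lt_ki|<-] := ltngtP i k; last first.
- by rewrite eqn_leq ltnn ltnNge leqnSn /= gap_nil // cdistxx cdistC; lia.
- have -> : (i.+1 == k) = false by lia.
  have -> : (i.+1 < k) = false by lia.
  by rewrite gap_recr // cdistxx (cdistC _ _ 1) cdist_1_glue; lia.
(* The new name lies on cycle [i.+1], which is either still before the cycle of [v] or equal to
   it. *)
- have [lt_ik'|?|<-] := ltngtP i.+1 k; try lia.
  + by rewrite (gap_recl i) // cdistxx cdist_1_glue; lia.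
  + by rewrite gap_nil // cdistxx cdistC; lia.
Qed.

Lemma canon_valid (x : nat * nat) :
  valid_name m n x -> valid_name m n (canon m n x).
Proof.
case: x => [i j] xv; rewrite /canon /=; case: andP => // -[lt_im _].
have := n_odd i.+1; rewrite /valid_name /=; lia.
Qed.

(** A renamed vertex has position 1, which is never a glue position. *)
Lemma canon_idem (x : nat * nat) : valid_name m n x ->
  canon m n (canon m n x) = canon m n x.
Proof.
case: x => [i j] xv; rewrite {2 3}/canon /=; case: andP => [[lt_im _]|H].
  rewrite /canon /=; case: andP => // -[? /eqP].
  by have := n_odd i.+1; rewrite /glue; lia.
by rewrite /canon /=; case: andP.
Qed.

Lemma canon_vertex (x : nat * nat) :
  valid_name m n x -> is_vertex m n (canon m n x).
Proof. by move=> xv; rewrite /is_vertex canon_valid // canon_idem ?eqxx. Qed.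

(** Valid names fit the bounds of the finite type, so [inord] does not fall back on its default
    value. *)
Lemma pr_vtx (x : nat * nat) :
  valid_name m n x -> pr m n (vtx m n x.1 x.2) = x.
Proof.
case: x => i j /andP[/= im jn]; rewrite /pr /vtx /= !inordK //; last by lia.
have im' : i < m.+1 by lia.
case/andP: jn => _ jn; rewrite ltnS (leq_trans jn) //.
exact: (leq_bigmax (F := fun t : 'I_m.+1 => n t) (Ordinal im')).
Qed.

Lemma vtx_pr (u : cname m n) : vtx m n (pr m n u).1 (pr m n u).2 = u.
Proof. by case: u => a b; rewrite /vtx /pr /= !inord_val. Qed.

Lemma chain_adjP (u w : cname m n) :
  reflect (exists i a b, [/\ valid_name m n (i, a), valid_name m n (i, b),
             cadj (n i) a b, canon m n (i, a) = pr m n u &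
             canon m n (i, b) = pr m n w])
          (chain_adj m n u w).
Proof.
apply: (iffP existsP) => [[a /existsP[b /and5P[]]]|[i [a [b [va vb ab ua wb]]]]].
  case: (pr m n a) (pr m n b) => [i a'] [k b'] va vb.
  case/andP=> /= /eqP ik ab /eqP ua /eqP wb; subst k.
  by exists i, a', b'.
exists (vtx m n i a); apply/existsP; exists (vtx m n i b).
rewrite (pr_vtx _ va) (pr_vtx _ vb) va vb ua wb !eqxx !andbT.
by rewrite /cyc_adj /= eqxx.
Qed.

Lemma ndist_desc (v x : nat * nat) : is_vertex m n v -> valid_name m n x ->
  x.2 != gate v x.1 ->
  exists y, [/\ valid_name m n y, y.1 = x.1, cadj (n x.1) y.2 x.2
              & ndist v x = (ndist v y).+1].
Proof.
case: x => i j /andP[vv _] /andP[/= im jn] jg.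
have [b [bn bj E]] := cdist_desc _ _ _ jn (gate_valid _ _ vv im) jg.
by exists (i, b); rewrite /valid_name /ndist /= im bn E addnS.
Qed.

Lemma gdist_ndist (u v : cname m n) :
  is_vertex m n (pr m n u) -> is_vertex m n (pr m n v) ->
  gdist (chain_adj m n) v u = ndist (pr m n v) (pr m n u).
Proof.
move=> uV vV; have /andP[vv /eqP cv] := vV.
apply: (gdist_potential _ _ (fun x => is_vertex m n (pr m n x)) _
  (fun x => ndist (pr m n v) (pr m n x))) => //.
- by rewrite /ndist /gate_dist /gate eqxx cdistxx.
- move=> x y /chain_adjP[i [a [b [va vb ab <- <-]]]].
  rewrite !ndist_canon // /ndist /= -addnS leq_add2l.
  move: va vb => /andP[/= im an] /andP[/= _ bn].
  by apply: cdist_lip => //; apply: gate_valid.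
move=> x xV xv; have /andP[vx /eqP cx] := xV.
(* A cut vertex must be left through the one of its two names that lies on the
   cycle towards [v]. *)
suff [x' [vx' cx' gx']] : exists x', [/\ valid_name m n x',
    canon m n x' = pr m n x & x'.2 != gate (pr m n v) x'.1].
  have [y [vy y1 ya yd]] := ndist_desc _ _ vV vx' gx'.
  have vcy := canon_valid _ vy.
  exists (vtx m n (canon m n y).1 (canon m n y).2).
  rewrite pr_vtx // canon_vertex // ndist_canon // -cx' ndist_canon //.
  split=> //; apply/chain_adjP; exists x'.1, y.2, x'.2.
  by rewrite -y1 -!surjective_pairing y1 -surjective_pairing pr_vtx.
have [g|] := boolP ((pr m n x).2 == gate (pr m n v) (pr m n x).1); last first.
  by exists (pr m n x).
have : pr m n x <> pr m n v.
  by move=> E; case/eqP: xv; rewrite -[x]vtx_pr E vtx_pr.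
move: vx cx g vv cv; rewrite /gate /canon.
case: (pr m n x) (pr m n v) => [i j] [k l] /= => /andP[/= im jn] cx g.
move=> /andP[/= km ln] cv xv'.
case: ltngtP g => [lt_ik|lt_ki|E] /eqP g.
(* With [i < k] the gate is the glue point, whose canonical name is on the next cycle, against [cx].
   With [k < i] the name on cycle [i.-1] works: its gate is 1, or, when [i.-1 = k], the position of
   [v], which is canonical and hence not the glue point. *)
- by move: cx; rewrite g eqxx; case: ltnP; [move=> _ [] |]; lia.
- have im' : 1 <= i.-1 <= m by lia.
  exists (i.-1, glue (n i.-1)).
  rewrite /valid_name [_.1]/= [_.2]/= im' glue_valid //.
  have -> : i.-1.+1 = i by lia.
  rewrite eqxx g; have -> : i <= m by lia.
  split=> //.
  have [|_|E] := ltngtP i.-1 k; first by lia.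
    have -> : (i <= k) = false by lia.
    by have := n_odd _ im'; rewrite /glue; lia.
  apply/eqP => gl; move: cv; rewrite -gl -E eqxx.
  by case: ltnP; [move=> _ [] |]; lia.
- by case: xv'; rewrite E g.
Qed.

Lemma max_distantP (u v : nat * nat) : in_V2 m n u -> is_vertex m n v ->
  max_distant (chain_adj m n) (vtx m n u.1 u.2) (vtx m n v.1 v.2) <->
  cdist (n u.1) u.2 (gate v u.1) = (n u.1)./2.
Proof.
move=> /andP[uV uV2] vV; have /andP[uv /eqP cu] := uV; have /andP[vv _] := vV.
have /andP[um un] := uv; have [on n3] := n_odd _ um.
rewrite -cdist_local_max ?(gate_valid _ _ vv um) //; last by lia.
rewrite /max_distant gdist_ndist ?pr_vtx // ndistC; split=> [H b bn ab|H w].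
  have vb : valid_name m n (u.1, b) by rewrite /valid_name um.
  have := H (vtx m n (canon m n (u.1, b)).1 (canon m n (u.1, b)).2).
  rewrite gdist_ndist ?pr_vtx ?canon_valid ?canon_vertex // ndist_canon //.
  rewrite /ndist leq_add2l; apply; apply/chain_adjP.
  by exists u.1, u.2, b; rewrite !pr_vtx ?canon_valid // -surjective_pairing.
case/chain_adjP=> i [a [b [va vb ab]]]; rewrite pr_vtx // => ua wb.
(* A proper renaming would give [u] position 1 on a cycle of index at least 2, which [V_2] excludes.
   So every edge at [u] comes from its own cycle, where [gate_dist] is constant and cancels. *)
have E : (i, a) = u.
  move: ua uV2; rewrite /canon /=; case: andP => [[lt_im _] <-|//].
  by move: va => /andP[/= im _] /=; lia.
rewrite gdist_ndist ?pr_vtx // -?wb ?canon_vertex // ndist_canon //.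
rewrite -E /ndist /= leq_add2l; move: vb H => /andP[_ bn].
by rewrite -E; apply.
Qed.

End Chain.

Theorem theorem3p6 (m : nat) (n : nat -> nat) (i j k l : nat) :
  2 <= m ->
  (forall t, 1 <= t <= m -> odd (n t) /\ 3 <= n t) ->
  in_V2 m n (i, j) -> in_V2 m n (k, l) -> (i, j) <> (k, l) ->
  let MMD := mutually_max_distant (chain_adj m n) (vtx m n i j) (vtx m n k l) in
  (* (a) *)
  (i = k -> (MMD <-> chain_dist m n (vtx m n i j) (vtx m n k l) = (n i).-1./2)) /\
  (* (b) *)
  (i < k ->
     (* (1) *)
     (i = 1 -> k = m ->
        (MMD <-> (j = 1 \/ j = 2) /\ (l = (n m).+1./2 \/ l = (n m).+1./2 + 1))) /\
     (* (2) *)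
     (i = 1 -> 2 <= k <= m - 1 ->
        (MMD <-> (j = 1 \/ j = 2) /\ l = (n k).+1./2)) /\
     (* (3) *)
     (2 <= i <= m - 1 -> k = m ->
        (MMD <-> j = 2 /\ (l = (n m).+1./2 \/ l = (n m).+1./2 + 1))) /\
     (* (4) *)
     (2 <= i -> k <= m - 1 ->
        (MMD <-> j = 2 /\ l = (n k).+1./2))).
Proof.
move=> m2 n_odd uV2 vV2 _ MMD.
have /andP[uV u2] := uV2; have /andP[vV v2] := vV2.
have /andP[uv /eqP cu] := uV; have /andP[vv /eqP cv] := vV.
have /andP[/= im jn] := uv; have /andP[/= km ln] := vv.
have [oi i3] := n_odd i im; have [ok k3] := n_odd k km.
have MMDE : MMD <-> cdist (n i) j (gate n (k, l) i) = (n i)./2 /\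
                    cdist (n k) l (gate n (i, j) k) = (n k)./2.
  have Hu := max_distantP m n n_odd _ _ uV2 vV.
  have Hv := max_distantP m n n_odd _ _ vV2 uV.
  by rewrite /MMD /mutually_max_distant Hu Hv.
split=> [E|lt_ik].
  (* On a common cycle each vertex is the gate of the other, so both conditions concern the same
     cycle distance, which is also the distance in the chain. *)
  rewrite MMDE /chain_dist (gdist_ndist m n n_odd) ?(pr_vtx _ _ (_, _)) //.
  rewrite /ndist /gate_dist /gate /= -E eqxx add0n cdistC [cdist _ l j]cdistC.
  have -> : (n i).-1./2 = (n i)./2 by lia.
  by split=> [[]|].
(* For [i < k] the gate on cycle [i] is its glue point and the gate on cycle [k] is position 1. *)
have {}MMDE : MMD <-> (j = 1 \/ j = 2) /\ (l = (n k).+1./2 \/ l = glue (n k)).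
  rewrite MMDE /gate /= [k == i]eq_sym.
  by case: ltngtP lt_ik => // _ _; rewrite cdist_antipode_glue ?cdist_antipode1.
(* Antipodes that are cut vertices are discarded: the glue point of a cycle before the last is not a
   canonical name, and position 1 on a later cycle is not in [V_2]. *)
have l_glue : k < m -> l <> glue (n k).
  by move=> lt_km E; move: cv; rewrite /canon /= lt_km E eqxx => -[]; lia.
have j1 : 2 <= i -> j <> 1 by move=> i2 E; move: u2; rewrite i2 E.
move: MMDE l_glue; rewrite /glue.
split=> [Ei Ek|]; first by subst k; rewrite MMDE addn1.
split=> [Ei Ek|]; first by rewrite MMDE; lia.
split=> [Ei Ek|Ei Ek]; last by rewrite MMDE; lia.
by subst k; rewrite MMDE addn1; lia.
Qed.
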